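(* Let $\alpha=(N;A,B,C,D;\mathbb{C}^r=\bigoplus_{j=1}^N\mathbb{C}^{r_j},\mathbb{C}^q,\mathbb{C}^p)$ be a GR-node. Let $P_k$ be the orthogonal projection of $\mathbb{C}^r$ onto $\mathbb{C}^{r_k}$ (naturally identified with a subspace of $\mathbb{C}^r$), and define the rational formal power series $$\varphi_k(z)=C(I_r-\Delta(z)A)^{-1}\big|_{\mathbb{C}^{r_k}},\qquad \psi_k(z)=P_k(I_r-A\Delta(z))^{-1}B,\qquad k=1,\ldots,N.$$ Let $\varepsilon=\|A\|^{-1}$ (with $\varepsilon>0$ arbitrary if $A=0$) and $\Gamma_n(\varepsilon)=\{Z\in(\mathbb{C}^{n\times n})^N:\ \|Z_k\|<\varepsilon,\ k=1,\ldots,N\}$. Then $\alpha$ is observable if and only if for every $k\in\{1,\ldots,N\}$ and every $n\in\mathbb{N}$ with $n\ge(pr-1)^{pr-1}$ (for every $n\in\mathbb{N}$ in the case $pr=1$), $$\bigcap_{Z\in\Gamma_n(\varepsilon)}\ker\varphi_k(Z)=0. \qquad (1)$$ Respectively, $\alpha$ is controllable if and only if for every $k\in\{1,\ldots,N\}$ and every $n\in\mathbb{N}$ with $n\ge(rq-1)^{rq-1}$ (for every $n\in\mathbb{N}$ in the case $rq=1$), $$\bigvee_{Z\in\Gamma_n(\varepsilon)}{\rm ran}\,\psi_k(Z)=\mathbb{C}^{r_k}\otimes\mathbb{C}^n, \qquad (2)$$ where $\bigvee$ denotes linear span. The GR-node $\alpha$ is minimal if both of these conditions (1) and (2) are fu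lfilled.
   Context: $\mathcal{F}_N$ is the free monoid on generators $g_1,\ldots,g_N$ with empty word. A GR-node $\alpha=(N;A,B,C,D;\mathbb{C}^r=\bigoplus_{j=1}^N\mathbb{C}^{r_j},\mathbb{C}^q,\mathbb{C}^p)$ consists of matrices $A\in\mathbb{C}^{r\times r}$, $B\in\mathbb{C}^{r\times q}$, $C\in\mathbb{C}^{p\times r}$, $D\in\mathbb{C}^{p\times q}$, with blocks $A_{ij}\in\mathbb{C}^{r_i\times r_j}$, $B_i\in\mathbb{C}^{r_i\times q}$, $C_j\in\mathbb{C}^{p\times r_j}$ along the decomposition of $\mathbb{C}^r$. $\Delta(z)={\rm diag}(z_1I_{r_1},\ldots,z_NI_{r_N})$ with $z_1,\ldots,z_N$ non-commuting indeterminates; the transfer function of $\alpha$ is the formal power series (FPS) $D+C(I_r-\Delta(z)A)^{-1}\Delta(z)B$. For $w=g_{j_1}\cdots g_{j_m}\in\mathcal{F}_N$ and $k\in\{1,\ldots,N\}$ put $(C\flat A)^{wg_k}=C_{j_1}A_{j_1j_2}\cdots A_{j_{m-1}j_m}A_{j_mk}$, $(C\flat A)^{g_k}=C_k$, and $(A\sharp B)^{g_kw}=A_{kj_1}A_{j_1j_2}\cdots A_{j_{m-1}j_m}B_{j_m}$, $(A\sharp B)^{g_k}=B_k$. The $k$-th observability matrix is $\mathcal{O}_k={\rm col}_{w\in\mathcal{F}_N}(C\flat A)^{wg_k}$ and the $k$-th controllability matrix is $\mathcal{C}_k={\rm row}_{w\in\mathcal{F}_N}(A\sharp B)^{g_kw^T}$,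 where $w^T$ is the reversed word. $\alpha$ is observable (resp. controllable) if ${\rm rank}\,\mathcal{O}_k=r_k$ (resp. ${\rm rank}\,\mathcal{C}_k=r_k$) for all $k=1,\ldots,N$. $\alpha$ is minimal if each $r_k$ is the smallest possible among all GR-nodes with the same transfer function (equivalently, $\alpha$ is observable and controllable). Evaluation of an FPS at $Z\in(\mathbb{C}^{n\times n})^N$ is by $f(Z)=\sum_wf_w\otimes Z^w$ near $0$; here, for $Z\in\Gamma_n(\varepsilon)$, $\varphi_k(Z)=(C\otimes I_n)(I_r\otimes I_n-\Delta(Z)(A\otimes I_n))^{-1}\big|_{\mathbb{C}^{r_k}\otimes\mathbb{C}^n}$ and $\psi_k(Z)=(P_k\otimes I_n)(I_r\otimes I_n-(A\otimes I_n)\Delta(Z))^{-1}(B\otimes I_n)$, where $\Delta(Z)={\rm diag}(I_{r_1}\otimes Z_1,\ldots,I_{r_N}\otimes Z_N)$. Norms are operator norms. *)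

(* Defs.v *)
From mathcomp Require Import all_boot all_order all_algebra.
From mathcomp Require Import complex mxtens.
From mathcomp Require Import classical_sets reals.

Set Implicit Arguments.
Unset Strict Implicit.
Unset Printing Implicit Defensive.

Import Order.TTheory GRing.Theory Num.Theory.
Local Open Scope ring_scope.

Notation "A *t B" := (tensmx A B)
  (at level 40, left associativity, format "A  *t  B") : ring_scope.

(** * Operator norm *)

(* The norm that the library puts on matrices is the maximum of the moduli of
   the entries, so the Euclidean norm and the operator norm it induces are
   defined here. *)
Definition l2norm (R : realType) m (x : 'cV[R[i]]_m) : R :=
  Num.sqrt (\sum_(i < m) ComplexField.Normc.normc (x i 0) ^+ 2).

Definition opnorm (R : realType) m n (M : 'M[R[i]]_(m, n)) : R :=
  sup [set y : R | exists2 x : 'cV[R[i]]_n, l2norm x <= 1 & y = l2norm (M *m x)]%classic.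

(** * Linear span *)

Definition linspan (K : pzRingType) (V : lmodType K) (S : set V) : set V :=
  [set v : V | exists s : seq (K * V),
     (forall a : K * V, a \in s -> S a.2) /\ v = \sum_(a <- s) a.1 *: a.2]%classic.

(** * Matrix-valued formal power series in N non-commuting indeterminates *)

(* The word g_{j_1} ... g_{j_m} is [:: j_1; ...; j_m]. *)
Definition word (N : nat) := seq 'I_N.

Definition fps (R : realType) (N m n : nat) := word N -> 'M[R[i]]_(m, n).

Section FPS.
Variables (R : realType) (N : nat).

Definition fps_const m n (M : 'M[R[i]]_(m, n)) : fps R N m n :=
  fun w => if w is [::] then M else 0.

Definition fps_add m n (f g : fps R N m n) : fps R N m n := fun w => f w + g w.

Definition fps_sub m n (f g : fps R N m n) : fps R N m n := fun w => f w - g w.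

Definition fps_mul m n l (f : fps R N m n) (g : fps R N n l) : fps R N m l :=
  fun w => \sum_(i < (size w).+1) f (take i w) *m g (drop i w).

Definition fps_exp m (f : fps R N m m) (k : nat) : fps R N m m :=
  iter k (fps_mul f) (fps_const 1%:M).

(* (I - f)^{-1} = \sum_k f^k, for f with zero constant term: the powers f^k
   with k > size w do not contribute to the coefficient of w. *)
Definition fps_inv1B m (f : fps R N m m) : fps R N m m :=
  fun w => \sum_(k < (size w).+1) fps_exp f k w.

Lemma fps_exp_eq0 m (f : fps R N m m) k (w : word N) :
  f [::] = 0 -> (size w < k)%N -> fps_exp f k w = 0.
Proof.
move=> f0; elim: k w => // k IHk w lt_wk.
rewrite /fps_exp iterS -/(fps_exp f k) /fps_mul big1 // => -[i lti] _ /=.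
case: i lti => [|i] lti; first by rewrite take0 f0 mul0mx.
rewrite IHk ?mulmx0 // size_drop; move: lti lt_wk; rewrite !ltnS => lti lt_wk.
by apply: leq_trans lt_wk; rewrite ltn_subrL /= (leq_trans _ lti).
Qed.

Lemma fps_inv1BP m (f : fps R N m m) : f [::] = 0 ->
  fps_mul (fps_sub (fps_const 1%:M) f) (fps_inv1B f) =1 fps_const 1%:M.
Proof.
move=> f0 w; set G := fps_inv1B f.
have Gn n (v : word N) : (size v <= n)%N ->
    G v = \sum_(k < n.+1) fps_exp f k v.
  move=> le_vn; rewrite /G /fps_inv1B -!(big_mkord xpredT (fun k => fps_exp f k v)).
  rewrite [RHS](big_cat_nat _ (n := (size v).+1)) //= [X in _ = _ + X]big_nat_cond.
  by rewrite [X in _ = _ + X]big1 ?addr0 // => k /andP[/andP[/(fps_exp_eq0 f0)]].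
have fG : fps_mul f G w = \sum_(k < (size w).+1) fps_exp f k.+1 w.
  rewrite /fps_mul.
  under eq_bigr => i _.
    rewrite (Gn (size w)) ?size_drop ?leq_subr // mulmx_sumr.
    over.
  by rewrite exchange_big.
have oneG : fps_mul (fps_const 1%:M) G w = G w.
  rewrite /fps_mul big_ord_recl /= take0 drop0 mul1mx big1 ?addr0 // => i _.
  have: size (take (bump 0 i) w) = i.+1 by rewrite size_takel // ltn_ord.
  by case: (take _ w) => // a s _; rewrite /fps_const mul0mx.
have -> : fps_mul (fps_sub (fps_const 1%:M) f) G w
    = fps_mul (fps_const 1%:M) G w - fps_mul f G w.
  by rewrite /fps_mul -sumrB; apply: eq_bigr => i _; rewrite -mulmxBl.
rewrite oneG fG (Gn (size w)) // [in X in X - _]big_ord_recl big_ord_recr /=.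
rewrite (_ : fps_mul f (iter (size w) (fps_mul f) (fps_const 1%:M)) w = 0).
  by rewrite addr0 addrK.
exact: (fps_exp_eq0 f0 (ltnSn (size w))).
Qed.

End FPS.

(** * GR-nodes *)

Record GRnode (R : realType) (N q p : nat) := MkGRnode {
  gr_dim : 'I_N -> nat;
  gr_A : 'M[R[i]]_(\sum_j gr_dim j);
  gr_B : 'M[R[i]]_(\sum_j gr_dim j, q);
  gr_C : 'M[R[i]]_(p, \sum_j gr_dim j);
  gr_D : 'M[R[i]]_(p, q) }.

Section GRnode.
Variables (R : realType) (N q p : nat) (alpha : GRnode R N q p).

Let r_ := gr_dim alpha.
Let A := gr_A alpha.
Let B := gr_B alpha.
Let C := gr_C alpha.
Let D := gr_D alpha.

Definition gr_order : nat := (\sum_j gr_dim alpha j)%N.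

Let r := gr_order.

Definition blockA (i j : 'I_N) : 'M[R[i]]_(r_ i, r_ j) := submxblock A i j.
Definition blockB (i : 'I_N) : 'M[R[i]]_(r_ i, q) := submxcol B i.
Definition blockC (j : 'I_N) : 'M[R[i]]_(p, r_ j) := submxrow C j.

(** ** Transfer function *)

Definition fps_Delta : fps R N r r := fun w =>
  if w is [:: k]
  then \mxdiag_(j < N) (if j == k then 1%:M : 'M[R[i]]_(r_ j) else 0)
  else 0.

Definition transfer : fps R N p q :=
  fps_add (fps_const D)
    (fps_mul (fps_const C)
       (fps_mul (fps_inv1B (fps_mul fps_Delta (fps_const A)))
          (fps_mul fps_Delta (fps_const B)))).

(** ** Observability and controllability *)

(* chainA j_1 [:: j_2; ...; j_m] k = A_{j_1 j_2} ... A_{j_{m-1} j_m} A_{j_m k} *)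
Fixpoint chainA (j : 'I_N) (w : word N) (k : 'I_N) : 'M[R[i]]_(r_ j, r_ k) :=
  if w is l :: w' then blockA j l *m chainA l w' k else blockA j k.

(* (C \flat A)^{w g_k} *)
Definition CflatA (w : word N) (k : 'I_N) : 'M[R[i]]_(p, r_ k) :=
  if w is j :: w' then blockC j *m chainA j w' k else blockC k.

(* (A \sharp B)^{g_k w} *)
Fixpoint AsharpB (k : 'I_N) (w : word N) : 'M[R[i]]_(r_ k, q) :=
  if w is j :: w' then blockA k j *m AsharpB j w' else blockB k.

Definition obs_mx (k : 'I_N) : word N -> 'M[R[i]]_(p, r_ k) :=
  fun w => CflatA w k.

Definition ctrl_mx (k : 'I_N) : word N -> 'M[R[i]]_(r_ k, q) :=
  fun w => AsharpB k (rev w).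

End GRnode.

(* The rank of the infinite block column col_w (F w) (resp. block row
   row_w (F w)) is the largest rank of the finite block columns (resp. rows)
   extracted from it. *)
Definition has_rank_col (R : realType) (N m n : nat)
    (F : word N -> 'M[R[i]]_(m, n)) (d : nat) : Prop :=
  let rk (ws : seq (word N)) := \rank (\mxcol_(i < size ws) F (nth [::] ws i)) in
  (exists ws, rk ws = d) /\ (forall ws, (rk ws <= d)%N).

Definition has_rank_row (R : realType) (N m n : nat)
    (F : word N -> 'M[R[i]]_(m, n)) (d : nat) : Prop :=
  let rk (ws : seq (word N)) := \rank (\mxrow_(i < size ws) F (nth [::] ws i)) in
  (exists ws, rk ws = d) /\ (forall ws, (rk ws <= d)%N).

Definition observable (R : realType) (N q p : nat) (alpha : GRnode R N q p) : Prop :=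
  forall k : 'I_N, has_rank_col (obs_mx alpha k) (gr_dim alpha k).

Definition controllable (R : realType) (N q p : nat) (alpha : GRnode R N q p) : Prop :=
  forall k : 'I_N, has_rank_row (ctrl_mx alpha k) (gr_dim alpha k).

Definition minimal (R : realType) (N q p : nat) (alpha : GRnode R N q p) : Prop :=
  forall beta : GRnode R N q p, transfer beta =1 transfer alpha ->
  forall k : 'I_N, (gr_dim alpha k <= gr_dim beta k)%N.

(** * Evaluation on tuples of matrices *)

Definition Gamma (R : realType) (N n : nat) (eps : R) : set ('I_N -> 'M[R[i]]_n) :=
  [set Z : 'I_N -> 'M[R[i]]_n | forall k, opnorm (Z k) < eps]%classic.

Section Evaluation.
Variables (R : realType) (N q p : nat) (alpha : GRnode R N q p).
Variables (n : nat) (Z : 'I_N -> 'M[R[i]]_n).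

Let r_ := gr_dim alpha.
Let r := gr_order alpha.
Let A : 'M[R[i]]_r := gr_A alpha.
Let B : 'M[R[i]]_(r, q) := gr_B alpha.
Let C : 'M[R[i]]_(p, r) := gr_C alpha.

Lemma Delta_dim : (\sum_j r_ j * n = r * n)%N.
Proof. by rewrite /r /gr_order big_distrl. Qed.

(* The cast only identifies the sum of the dimensions r_j n with r n. *)
Definition Delta_at : 'M[R[i]]_(r * n) :=
  castmx (Delta_dim, Delta_dim)
    (\mxdiag_(j < N) ((1%:M : 'M[R[i]]_(r_ j)) *t Z j)).

(* The orthogonal projection of C^r onto its k-th summand C^{r_k}, and the
   inclusion of C^{r_k} into C^r. *)
Definition gr_proj (k : 'I_N) : 'M[R[i]]_(r_ k, r) := submxcol 1%:M k.
Definition gr_incl (k : 'I_N) : 'M[R[i]]_(r, r_ k) := submxrow 1%:M k.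

(* When every Z_k has norm less than 1 / ||A||, the matrices inverted below are
   invertible. *)
Definition phi_at (k : 'I_N) : 'M[R[i]]_(p * n, r_ k * n) :=
  (C *t (1%:M : 'M[R[i]]_n))
    *m invmx (1%:M - Delta_at *m (A *t (1%:M : 'M[R[i]]_n)))
    *m (gr_incl k *t (1%:M : 'M[R[i]]_n)).

Definition psi_at (k : 'I_N) : 'M[R[i]]_(r_ k * n, q * n) :=
  (gr_proj k *t (1%:M : 'M[R[i]]_n))
    *m invmx (1%:M - (A *t (1%:M : 'M[R[i]]_n)) *m Delta_at)
    *m (B *t (1%:M : 'M[R[i]]_n)).

End Evaluation.

Definition mxker (K : pzRingType) m n (M : 'M[K]_(m, n)) : set 'cV[K]_n :=
  [set u : 'cV[K]_n | M *m u = 0]%classic.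

Definition mxran (K : pzRingType) m n (M : 'M[K]_(m, n)) : set 'cV[K]_m :=
  [set v : 'cV[K]_m | exists u : 'cV[K]_n, v = M *m u]%classic.

(* The positive sizes n allowed by the bound n >= (d - 1)^(d - 1), which is
   dropped when d = 1.  When d = 0 the truncated d.-1 gives 0 ^ 0 = 1, so
   that again every n >= 1 is allowed. *)
Definition admissible_size (d n : nat) : Prop :=
  (1 <= n)%N /\ (d <> 1%N -> (d.-1 ^ d.-1 <= n)%N).

Definition kernel_condition (R : realType) (N q p : nat)
    (alpha : GRnode R N q p) (eps : R) : Prop :=
  forall (k : 'I_N) (n : nat), admissible_size (p * gr_order alpha) n ->
  (\bigcap_(Z in @Gamma R N n eps) mxker (phi_at alpha Z k) = [set 0])%classic.

Definition range_condition (R : realType) (N q p : nat)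
    (alpha : GRnode R N q p) (eps : R) : Prop :=
  forall (k : 'I_N) (n : nat), admissible_size (gr_order alpha * q) n ->
  (linspan (\bigcup_(Z in @Gamma R N n eps) mxran (psi_at alpha Z k)) = [set: _])%classic.

(* Main.v *)
(** In phi_k(Z) the variable enters through T = \sum_j M_j (x) Z_j with
M_j = E_j A, where E_j is the orthogonal projection onto the j-th summand, and
(C \flat A)^{w g_k} = C M_{j_1} ... M_{j_m} |_{C^{r_k}}.

If alpha is observable and phi_k(Z) x = 0 on Gamma_n(eps), then replacing Z by
t Z with infinitely many small t shows that every coefficient
(C (x) 1) T^m x vanishes, for every Z.  For a word w of length m <= n
choose Z_1, ..., Z_N so that their arrows form one cycle of length m through the
basis vector e_mu, labelled by the successive letters of w: then
(C (x) e_mu) T^m = C M_w (x) e_mu, so C M_w kills the mu-th slice of x.  Since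
the row spaces spanned by the C M_w with |w| <= m grow strictly until they
stabilize, words of length <= r - 1 suffice, and r - 1 <= (pr - 1)^(pr - 1).

Conversely the row space W spanned by all C M_w satisfies W M_j <= W, hence
W (x) 1 is invariant under 1 - T and under its inverse, so phi_k(Z) kills
v (x) u whenever v is unobservable.

Controllability is observability of the transposed node, and minimality follows
from the factorization of the Hankel matrix of the transfer function as
O_k * C_k, whose rank is r_k. *)

Require Import Defs.
From mathcomp Require Import all_boot all_order all_algebra perm.
From mathcomp Require Import complex mxtens.
From mathcomp Require Import boolp classical_sets reals.

Set Implicit Arguments.
Unset Strict Implicit.
Unset Printing Implicit Defensive.

Import Order.TTheory GRing.Theory Num.Theory.
Local Open Scope ring_scope.

(** * Kronecker products *)

Section Tensor.
Variable F : comNzRingType.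

Lemma tensmxZr m n p q a (A : 'M[F]_(m, n)) (X : 'M[F]_(p, q)) :
  A *t (a *: X) = a *: (A *t X).
Proof. by apply/matrixP=> i j; rewrite !mxE mulrCA. Qed.

Definition tens_slice m n (mu : 'I_n) (x : 'cV[F]_(m * n)) : 'cV[F]_m :=
  \col_i x (mxtens_index (i, mu)) 0.

Lemma tens_delta_mul k m n (A : 'M[F]_(k, m)) mu (x : 'cV[F]_(m * n)) i :
  ((A *t delta_mx (0 : 'I_1) mu) *m x) (mxtens_index (i, 0)) 0
    = (A *m tens_slice mu x) i 0.
Proof.
rewrite !mxE (reindex (@mxtens_index m n)) /=; last first.
  by exists (@mxtens_unindex m n) => ? _; rewrite ?mxtens_indexK ?mxtens_unindexK.
rewrite (eq_bigr (fun q => A i q.1 * (mu == q.2)%:R * x (mxtens_index (q.1, q.2)) 0)).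
  rewrite -(pair_bigA _
    (fun j nu => A i j * (mu == nu)%:R * x (mxtens_index (j, nu)) 0)).
  apply: eq_bigr => j _; rewrite (bigD1 mu) //= eqxx mulr1 big1 ?addr0 ?mxE //.
  by move=> nu /negPf; rewrite eq_sym => ->; rewrite mulr0 mul0r.
by case=> j nu _; rewrite tensmxE mxE eqxx /= eq_sym.
Qed.

Lemma tens_slice_eq0 m n (x : 'cV[F]_(m * n)) :
  (forall mu, tens_slice mu x = 0) -> x = 0.
Proof.
move=> x0; apply/matrixP=> i j; rewrite ord1; case: (mxtens_indexP i) => i1 mu.
by have /matrixP/(_ i1 0) := x0 mu; rewrite !mxE.
Qed.

End Tensor.

(** * Row spaces generated by products along words *)

Section WordProducts.
Variables (F : fieldType) (I : finType) (r p : nat).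
Variables (M : I -> 'M[F]_r) (C : 'M[F]_(p, r)).

Definition word_mx (w : seq I) : 'M[F]_r := \prod_(j <- w) M j.

Lemma word_mx_cons j w : word_mx (j :: w) = M j *m word_mx w.
Proof. by rewrite /word_mx big_cons. Qed.

Lemma word_mx_rcons w j : word_mx (rcons w j) = word_mx w *m M j.
Proof. by rewrite /word_mx -cats1 big_cat big_seq1. Qed.

(** The span of the rows of all [C *m word_mx w] with [size w <= m], grown letter by letter like a
    Krylov sequence. *)
Fixpoint rowspan (m : nat) : 'M[F]_r :=
  if m is m'.+1 then (rowspan m' + \sum_j rowspan m' *m M j)%MS else <<C>>%MS.

Lemma rowspan_sub m w : (size w <= m)%N -> (C *m word_mx w <= rowspan m)%MS.
Proof.
elim: m w => [|m IHm] w /=.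
  by case: w => // _; rewrite /word_mx big_nil mulmx1 genmxE.
case: (lastP w) => [|w' j].
  by move=> _; rewrite (submx_trans (IHm [::] _)) // addsmxSl.
rewrite size_rcons ltnS => /IHm sub_w; rewrite word_mx_rcons mulmxA.
apply: submx_trans (submxMr _ sub_w) (submx_trans _ (addsmxSr _ _)).
exact: (sumsmx_sup j).
Qed.

Lemma rowspan_stationary_step m :
  (rowspan m.+1 <= rowspan m)%MS -> (rowspan m.+2 <= rowspan m.+1)%MS.
Proof.
move=> st; rewrite [rowspan m.+2]/= addsmx_sub submx_refl /=.
apply/sumsmx_subP => j _; apply: submx_trans (submxMr _ st) _ => /=.
by rewrite (submx_trans _ (addsmxSr _ _)) // (sumsmx_sup j).
Qed.

(** Until it stabilizes, the chain gains a dimension at each step, starting from rank at least 1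
    when [C] is nonzero. *)
Lemma rowspan_stationary_or_large m :
  (rowspan m.+1 <= rowspan m)%MS || (m < \rank (rowspan m))%N.
Proof.
elim: m => [|m IHm].
  have [C0|C0] := eqVneq C 0; last by rewrite /= mxrank_gen lt0n mxrank_eq0 C0 orbT.
  by rewrite /= C0 genmx0 big1 ?addsmx0 ?submx_refl // => j _; rewrite mul0mx.
have [/rowspan_stationary_step->//|nst /=] := boolP (rowspan m.+1 <= rowspan m)%MS.
rewrite (negPf nst) in IHm; apply/orP; right; apply: leq_ltn_trans IHm _.
rewrite ltn_neqAle mxrankS ?addsmxSl // andbT; apply: contra nst => eq_rk.
by rewrite -(geq_leqif (mxrank_leqif_sup (addsmxSl _ _))) (eqP eq_rk).
Qed.

Lemma rowspan_stationary : (rowspan r.-1.+1 <= rowspan r.-1)%MS.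
Proof.
have /orP[//|rk_r] := rowspan_stationary_or_large r.-1; apply: submx_full.
by rewrite /row_full eqn_leq rank_leq_col (leq_trans (leqSpred r)).
Qed.

Lemma rowspan_stable j : (rowspan r.-1 *m M j <= rowspan r.-1)%MS.
Proof.
have := rowspan_stationary; apply: submx_trans.
by rewrite /= (submx_trans _ (addsmxSr _ _)) // (sumsmx_sup j).
Qed.

Lemma word_mx_sub w : (C *m word_mx w <= rowspan r.-1)%MS.
Proof.
elim/last_ind: w => [|w j IHw]; first exact: rowspan_sub.
rewrite word_mx_rcons mulmxA (submx_trans (submxMr _ IHw)) //.
exact: rowspan_stable.
Qed.

(** [y] stays general because the induction moves the last letter of the word into it. *)
Lemma rowspan_eq0 m l (y : 'M[F]_(r, l)) :
  (forall w, (size w <= m)%N -> C *m word_mx w *m y = 0) -> rowspan m *m y = 0.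
Proof.
elim: m l y => [|m IHm] l y Cy.
  apply/sub_kermxP; rewrite /= genmxE; apply/sub_kermxP.
  by have := Cy [::] isT; rewrite /word_mx big_nil mulmx1.
apply/sub_kermxP; rewrite /= addsmx_sub; apply/andP; split.
  by apply/sub_kermxP/IHm => w le_wm; apply: Cy; apply: leqW.
apply/sumsmx_subP => j _; apply/sub_kermxP; rewrite -mulmxA; apply: IHm => w le_wm.
by rewrite mulmxA -(mulmxA C) -word_mx_rcons Cy // size_rcons.
Qed.

End WordProducts.

(** * Resolvents and matrix pencils *)

Section Resolvent.
Variables (F : numFieldType) (d p l : nat).

Lemma poly_eq0_infinite (P : {poly F}) (t : nat -> F) :
  injective t -> (forall n, root P (t n)) -> P = 0.
Proof.
move=> t_inj Pt0; apply/eqP/negP => /negP P0.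
have := max_poly_roots P0 (rs := [seq t n | n <- iota 0 (size P)]).
rewrite map_inj_uniq ?iota_uniq // size_map size_iota ltnn.
suff -> : all (root P) [seq t n | n <- iota 0 (size P)] by move=> /(_ isT isT).
by apply/allP => _ /mapP[n _ ->].
Qed.

Let pencil (T : 'M[F]_d) : 'M[{poly F}]_d := 1%:M - 'X *: map_mx polyC T.

Let pencilE (T : 'M[F]_d) t : map_mx (horner_eval t) (pencil T) = 1%:M - t *: T.
Proof.
apply/matrixP => i j; rewrite !mxE /horner_eval !hornerE mulrC.
by case: (i == j); rewrite ?hornerE //= ?hornerE; case: (i == j); rewrite /= ?hornerE.
Qed.

(* The values t n at which 1 - t n *: T is singular, where invmx is a junk
   value, are harmless: multiplying by the determinant turns the hypothesis into
   a polynomial identity in t that holds there too. *)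
Lemma resolvent_coef (T : 'M[F]_d) (C : 'M[F]_(p, d)) (y : 'M[F]_(d, l))
    (t : nat -> F) : injective t -> (forall n, t n != 0) ->
  (forall n, C *m invmx (1%:M - t n *: T) *m y = 0) ->
  forall m, C *m T ^+ m *m y = 0.
Proof.
move=> t_inj t_neq0 Cy0.
pose R_ n := invmx (1%:M - t n *: T).
(* The value at t = 0 is reached algebraically: the determinant is 1 there, hence a nonzero
   polynomial, so the numerator [Q] vanishes, and its value at 0 is an entry of [D *m y]. *)
have at0 (D : 'M[F]_(p, d)) :
    (forall n, 1%:M - t n *: T \in unitmx -> D *m R_ n *m y = 0) -> D *m y = 0.
  move=> Dy0; apply/matrixP=> i j; rewrite [RHS]mxE.
  pose Q := (map_mx polyC D *m \adj (pencil T) *m map_mx polyC y) i j.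
  have QE s : Q.[s] = (D *m \adj (1%:M - s *: T) *m y) i j.
    transitivity (map_mx (horner_eval s)
      (map_mx polyC D *m \adj (pencil T) *m map_mx polyC y) i j).
      by rewrite [RHS]mxE.
    rewrite !map_mxM map_mx_adj pencilE.
    by rewrite -!map_mx_comp !map_mx_id // => x; rewrite /= /horner_eval hornerC.
  have detE s : (\det (pencil T)).[s] = \det (1%:M - s *: T).
    by rewrite -pencilE det_map_mx.
  have : \det (pencil T) * Q = 0.
    apply: (poly_eq0_infinite t_inj) => n; rewrite rootM /root QE detE.
    have [//|det_neq0] := eqVneq; apply/eqP.
    have U : 1%:M - t n *: T \in unitmx by rewrite unitmxE unitfE.
    have := Dy0 n U; rewrite /R_ /invmx U -scalemxAr -scalemxAl.
    move=> /matrixP/(_ i j); rewrite mxE [X in _ = X -> _]mxE.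
    by move=> /eqP; rewrite mulf_eq0 invr_eq0 (negPf det_neq0) => /eqP.
  move=> /eqP; rewrite mulf_eq0 => /orP[/eqP det0|/eqP Q0].
    have := detE 0; rewrite det0 horner0 scale0r subr0 det1 => /esym/eqP.
    by rewrite oner_eq0.
  have := QE 0; rewrite Q0 horner0 scale0r subr0.
  have -> : \adj (1%:M : 'M[F]_d) = 1%:M.
    by have := mul_mx_adj (1%:M : 'M[F]_d); rewrite mul1mx det1.
  by rewrite mulmx1.
(* Expanding R = 1 + t T R peels off one power of [T]: the term free of R vanishes by [at0], and
   dividing by [t n] leaves the claim for [m.+1]. *)
have step m : forall n, 1%:M - t n *: T \in unitmx -> C *m T ^+ m *m R_ n *m y = 0.
  elim: m => [|m IHm] n U; first by rewrite expr0 mulmx1 Cy0.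
  have : R_ n = 1%:M + t n *: (T *m R_ n).
    apply/eqP; rewrite -subr_eq; apply/eqP.
    by rewrite -[in RHS](mulmxV U) mulmxBl mul1mx scalemxAl.
  move=> /(congr1 (fun X => C *m T ^+ m *m X *m y)); rewrite IHm //.
  rewrite mulmxDr mulmxDl mulmx1 (at0 _ IHm) add0r -scalemxAr -scalemxAl.
  move=> /esym/eqP; rewrite scaler_eq0 (negPf (t_neq0 n)) /= => /eqP.
  by rewrite exprSr !mulmxA.
by move=> m; apply: at0; apply: step.
Qed.

End Resolvent.

(* This includes the singular case, where invmx f = f. *)
Lemma stablemx_inv (F : fieldType) m d (V : 'M[F]_(m, d)) (f : 'M[F]_d) :
  stablemx V f -> stablemx V (invmx f).
Proof.
have [Uf Vf|/invmx_out-> //] := boolP (f \in unitmx).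
have : (V <= V *m f)%MS.
  by rewrite -(geq_leqif (mxrank_leqif_sup Vf)) mxrankMfree // row_free_unit.
by move=> /(submxMr (invmx f)); rewrite mulmxK.
Qed.

(** * Tensor pencils and their evaluation on cycles *)

Section TensorPencil.
Variables (F : fieldType) (I : finType) (r : nat) (M : I -> 'M[F]_r).

Definition tpencil n (Z : I -> 'M[F]_n) : 'M[F]_(r * n) := \sum_j M j *t Z j.

Lemma tpencilZ n a (Z : I -> 'M[F]_n) :
  tpencil (fun j => a *: Z j) = a *: tpencil Z.
Proof. by rewrite scaler_sumr; apply: eq_bigr => j _; rewrite tensmxZr. Qed.

Lemma stablemx_tpencil m n (W : 'M[F]_(m, r)) (Z : I -> 'M[F]_n) :
  (forall j, stablemx W (M j)) -> stablemx (W *t (1%:M : 'M[F]_n)) (tpencil Z).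
Proof.
move=> stW; rewrite mulmx_sumr summx_sub // => j _.
have /submxP[X WM] := stW j; rewrite tensmx_mul mul1mx WM.
apply/submxP; exists (X *t Z j); by rewrite tensmx_mul mulmx1.
Qed.

Section Cycle.
Variables (n : nat) (w : seq I) (mu : 'I_n.+1).

Let node (i : nat) : 'I_n.+1 := tperm ord0 mu (inord i).

(* The arrows form a cycle node 0 = mu -> node 1 -> ... -> node 0 of length
   size w, the i-th one being carried by the letter w_i only; so w is the only
   word of that length whose product has a nonzero row of index mu, and this row
   is e_mu.  Closing the walk up makes n >= size w sufficient, instead of
   n > size w. *)
Definition cycle_mx (j : I) : 'M[F]_n.+1 :=
  \sum_(i < size w | tnth (in_tuple w) i == j)
     delta_mx (node i) (node (i.+1 %% size w)).

Hypothesis le_wn : (size w <= n.+1)%N.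

(** Since [size w <= n.+1], the vertices of the cycle are distinct; a single arrow leaves [node i],
    and its letter selects the surviving term of the pencil. *)
Lemma cycle_step p (Y : 'M[F]_(p, r)) (i : 'I_(size w)) :
  (Y *t delta_mx (0 : 'I_1) (node i)) *m tpencil cycle_mx
    = (Y *m M (tnth (in_tuple w) i)) *t delta_mx 0 (node (i.+1 %% size w)).
Proof.
rewrite mulmx_sumr (bigD1 (tnth (in_tuple w) i)) //= tensmx_mul.
have node_eq (k : 'I_(size w)) : (node i == node k) = (i == k).
  rewrite (inj_eq perm_inj) -val_eqE /= !inordK ?(leq_trans (ltn_ord _)) //.
rewrite [X in _ + X]big1 ?addr0 => [|j /negPf w_neq].
  congr (_ *t _); rewrite mulmx_sumr (bigD1 i) //= mul_delta_mx_cond eqxx.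
  rewrite big1 ?addr0 // => k /andP[_ /negPf k_neq].
  by rewrite mul_delta_mx_cond node_eq eq_sym k_neq.
rewrite tensmx_mul mulmx_sumr big1 ?tensmx0 // => k /eqP wk.
rewrite mul_delta_mx_cond node_eq; case: eqP => // ik.
by rewrite -wk ik eqxx in w_neq.
Qed.

Lemma cycle_walk p (C : 'M[F]_(p, r)) :
  (C *t delta_mx (0 : 'I_1) mu) *m tpencil cycle_mx ^+ size w
    = (C *m word_mx M w) *t delta_mx 0 mu.
Proof.
have node0 : node 0 = mu.
  have inord0 : inord 0 = ord0 :> 'I_n.+1 by apply: val_inj; rewrite /= inordK.
  by rewrite /node inord0 tpermL.
suff walk k : (k <= size w)%N ->
    (C *t delta_mx (0 : 'I_1) mu) *m tpencil cycle_mx ^+ k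
      = (C *m word_mx M (take k w)) *t delta_mx 0 (node (k %% size w)).
  by rewrite walk // take_size modnn node0.
elim: k => [|k IHk] lt_kw.
  by rewrite mulmx1 take0 /word_mx big_nil mulmx1 mod0n node0.
rewrite exprSr mulmxA IHk 1?ltnW // modn_small //.
rewrite (cycle_step _ (Ordinal lt_kw)); congr (_ *t _).
rewrite -mulmxA -word_mx_rcons; congr (_ *m word_mx _ _).
set x0 := tnth _ _; rewrite (take_nth x0) //; congr (rcons _ _).
exact: (tnth_nth x0 (in_tuple w) (Ordinal lt_kw)).
Qed.

End Cycle.
End TensorPencil.

(** * Detecting vectors through the resolvent *)

Section Detection.
Variables (F : numFieldType) (I : finType) (r p s : nat).
Variables (M : I -> 'M[F]_r) (C : 'M[F]_(p, r)) (L : 'M[F]_(r, s)).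

Definition tresolvent n (Z : I -> 'M[F]_n) : 'M[F]_(p * n, s * n) :=
  (C *t (1%:M : 'M[F]_n)) *m invmx (1%:M - tpencil M Z) *m (L *t (1%:M : 'M[F]_n)).

(** [C *t 1] factors through [W *t 1], which invariance carries past the inverse to meet
    [W *m (L *m v) = 0]. *)
Lemma tresolvent_eq0 n (Z : I -> 'M[F]_n) (v : 'cV[F]_s) (u : 'cV[F]_n) :
  (forall w, C *m word_mx M w *m (L *m v) = 0) -> tresolvent Z *m (v *t u) = 0.
Proof.
move=> Cv0; set W := rowspan M C r.-1.
have st : stablemx (W *t (1%:M : 'M[F]_n)) (invmx (1%:M - tpencil M Z)).
  apply: stablemx_inv; apply: stablemxD; first exact: stablemxC.
  by rewrite stablemxN; apply: stablemx_tpencil => j; apply: rowspan_stable.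
have /submxP[X CE] : (C <= W)%MS.
  by have := word_mx_sub M C [::]; rewrite /word_mx big_nil mulmx1.
have /submxP[Y WE] := st.
have CWE : C *t (1%:M : 'M[F]_n) = (X *t 1%:M) *m (W *t 1%:M).
  by rewrite tensmx_mul mulmx1 -CE.
rewrite /tresolvent CWE -(mulmxA (X *t _)) WE -!mulmxA !tensmx_mul mul1mx.
by rewrite mulmxA rowspan_eq0 ?tens0mx ?mulmx0.
Qed.

(** For [p = 0] the admissible sizes do not bound [r], whence the first alternative: the products
    then have no rows and [obs] applies at once. *)
Lemma tresolvent_detect n (x : 'cV[F]_(s * n.+1)) :
  (p == 0)%N || (r.-1 <= n.+1)%N ->
  (forall v : 'cV[F]_s, (forall w, C *m word_mx M w *m (L *m v) = 0) -> v = 0) ->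
  (forall Z : I -> 'M[F]_n.+1, exists t : nat -> F,
     [/\ injective t, forall i, t i != 0
       & forall i, tresolvent (fun j => t i *: Z j) *m x = 0]) ->
  x = 0.
Proof.
move=> size_n obs x0; apply: tens_slice_eq0 => mu; set v := tens_slice mu x.
have Cv w : (size w <= n.+1)%N -> C *m word_mx M w *m (L *m v) = 0.
  move=> le_wn; have [t [t_inj t_neq0 tx0]] := x0 (@cycle_mx F I n w mu).
  have := @resolvent_coef _ _ _ _ (tpencil M (@cycle_mx F I n w mu)) (C *t 1%:M)
    ((L *t 1%:M) *m x) t t_inj t_neq0.
  move=> Cx0; have /Cx0/(_ (size w)) : forall i,
      C *t 1%:M *m invmx (1%:M - t i *: tpencil M (@cycle_mx F I n w mu))
      *m ((L *t 1%:M) *m x) = 0.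
    by move=> i; rewrite -tpencilZ mulmxA; apply: tx0.
  (* The left factor isolates the row of the cycle that starts at [mu]. *)
  move=> /(congr1 (mulmx ((1%:M : 'M_p) *t delta_mx (0 : 'I_1) mu))).
  rewrite mulmx0 !mulmxA tensmx_mul mul1mx mulmx1 cycle_walk // tensmx_mul mulmx1.
  move=> Cwx0; apply/matrixP=> i j; rewrite ord1 -tens_delta_mul.
  by rewrite Cwx0 !mxE.
apply: obs => w; have /orP[/eqP p0|le_rn] := size_n.
  by apply/matrixP=> -[i lt_ip]; exfalso; move: lt_ip; rewrite p0.
have W0 : rowspan M C r.-1 *m (L *m v) = 0.
  by apply: rowspan_eq0 => w' /leq_trans/(_ le_rn); apply: Cv.
by have /submxP[X ->] := word_mx_sub M C w; rewrite -mulmxA W0 mulmx0.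
Qed.

End Detection.

(** * Ranks of infinite families *)

(** Greedy choice: below full rank some [G t] enlarges the span, as otherwise a nonzero vector
    killed by the span would be killed by the whole family. *)
Lemma row_full_family (F : fieldType) (T : Type) m n (G : T -> 'M[F]_(m, n)) :
  (forall v : 'cV[F]_n, (forall t, G t *m v = 0) -> v = 0) ->
  exists ts : seq T, row_full (\sum_(t <- ts) <<G t>>)%MS.
Proof.
move=> G0; suff rk_ge d : (d <= n)%N ->
    exists ts : seq T, (d <= \rank (\sum_(t <- ts) <<G t>>)%MS)%N.
  have [ts rk_ts] := rk_ge n (leqnn n).
  by exists ts; rewrite /row_full eqn_leq rank_leq_col.
elim: d => [|d IHd] lt_dn; first by exists [::].
have [ts] := IHd (ltnW lt_dn); rewrite leq_eqVlt.
move=> /orP[/eqP rk_ts|lt_rk]; last by exists ts.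
have [//|nex] := EM (exists ts : seq T, (d < \rank (\sum_(t <- ts) <<G t>>)%MS)%N).
set S := (\sum_(t <- ts) _)%MS in rk_ts.
have G_S t : (G t <= S)%MS.
  apply: contrapT => nGS; apply: nex; exists (t :: ts).
  rewrite big_cons -/S rk_ts ltn_neqAle mxrankS ?addsmxSr // andbT.
  apply/negP => /eqP rk_eq; apply: nGS; rewrite -genmxE.
  have := mxrank_leqif_sup (addsmxSr <<G t>>%MS S) => /geq_leqif.
  by rewrite rk_eq leqnn => /esym; rewrite addsmx_sub => /andP[].
have : kermx S^T != 0.
  by rewrite kermx_eq0 /row_free mxrank_tr -rk_ts ltn_eqF.
move=> /rowV0Pn[v /sub_kermxP vS0 /negP[]]; rewrite -trmx_eq0; apply/eqP/G0 => t.
have /submxP[X ->] := G_S t.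
by rewrite -mulmxA -[S]trmxK -trmx_mul vS0 trmx0 mulmx0.
Qed.

Lemma has_rank_colP (R : realType) N m n (G : word N -> 'M[R[i]]_(m, n)) :
  has_rank_col G n <-> forall v : 'cV_n, (forall w, G w *m v = 0) -> v = 0.
Proof.
have rkE (ws : seq (word N)) : \rank (\mxcol_(i < size ws) G (nth [::] ws i)) =
    \rank (\sum_(w <- ws) <<G w>>)%MS.
  by rewrite eqmx_col (big_nth [::]) big_mkord.
split=> [[[ws rk_ws] _] v Gv0|/row_full_family[ws /eqP full_ws]]; last first.
  by split=> [|ws']; [exists ws; rewrite rkE | apply: rank_leq_col].
have : row_full (\mxcol_(i < size ws) G (nth [::] ws i)) by rewrite /row_full rk_ws.
case/row_fullP => B B1; rewrite -[v]mul1mx -B1 -mulmxA mxcol_mul.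
by rewrite (_ : mxcol _ = 0) ?mulmx0 // -(mxcol0 1); apply: eq_mxcol => i; rewrite Gv0.
Qed.

(** [conform_mx] acts as a cast: [i] and [j] may be equal only propositionally, and [X i] must take
    the dimensions of the block. *)
Lemma mxdiag_Rank (V : nmodType) l (d : 'I_l -> nat) (X : forall i, 'M[V]_(d i))
    i j (a : 'I_(d i)) (b : 'I_(d j)) :
  (\mxdiag_k X k) (tagnat.Rank i a) (tagnat.Rank j b)
    = (if i == j then conform_mx 0 (X i) else 0) a b.
Proof.
have /matrixP/(_ a b) := mxblockK
  (fun i j => if i == j then conform_mx 0 (X i) else 0 : 'M[V]_(d i, d j)) i j.
by rewrite mxE => <-.
Qed.

(** * GR-nodes *)

Section Node.
Variables (R : realType) (N q p : nat) (alpha : GRnode R N q p).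
Local Notation A := (gr_A alpha).
Local Notation B := (gr_B alpha).
Local Notation C := (gr_C alpha).
Local Notation incl := (gr_incl alpha).
Local Notation proj := (gr_proj alpha).

Definition gr_step (j : 'I_N) : 'M[R[i]]_(gr_order alpha) := incl j *m proj j *m A.

Lemma gr_proj_mul k m (X : 'M_(gr_order alpha, m)) : proj k *m X = submxcol X k.
Proof. by rewrite -[X in RHS]mul1mx submxcol_mul. Qed.

Lemma mul_gr_incl k m (X : 'M_(m, gr_order alpha)) : X *m incl k = submxrow X k.
Proof. by rewrite -[X in RHS]mulmx1 mul_submxrow. Qed.

Lemma blockAE j k : blockA alpha j k = proj j *m A *m incl k.
Proof. by rewrite mul_gr_incl gr_proj_mul -submxblockEv. Qed.

Lemma chainAE j w k :
  chainA alpha j w k = proj j *m A *m word_mx gr_step w *m incl k.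
Proof.
elim: w j => [|l w IHw] j /=; first by rewrite /word_mx big_nil mulmx1 blockAE.
by rewrite blockAE IHw word_mx_cons /gr_step !mulmxA.
Qed.

Lemma CflatAE w k : CflatA alpha w k = C *m word_mx gr_step w *m incl k.
Proof.
rewrite /CflatA /blockC; case: w => [|j w].
  by rewrite /word_mx big_nil mulmx1 mul_gr_incl.
by rewrite chainAE word_mx_cons -mul_gr_incl /gr_step !mulmxA.
Qed.

Lemma gr_proj_incl j k :
  proj j *m incl k = if j == k then conform_mx 0 (1%:M : 'M_(gr_dim alpha j)) else 0.
Proof.
rewrite gr_proj_mul /gr_incl -submxblockEh -(mxdiagZ 1) mxblockK.
by case: eqVneq => [->|]; rewrite ?conform_mx_id.
Qed.

Lemma gr_incl_proj k :
  incl k *m proj k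
    = \mxdiag_j (if j == k then 1%:M : 'M[R[i]]_(gr_dim alpha j) else 0).
Proof.
apply/mxblockP => i j; rewrite mxblockK submxblockEv -submxcol_mul -mul_submxrow.
rewrite -gr_proj_mul -mul_gr_incl !gr_proj_incl.
have [->|ik] := eqVneq i k; last first.
  by rewrite mul0mx; case: eqP => // <-; rewrite conform_mx_id.
by have [->|//] := eqVneq k j; rewrite ?conform_mx_id ?mulmx1 // mulmx0.
Qed.

Section Evaluation.
Variables (n : nat) (Z : 'I_N -> 'M[R[i]]_n).

Lemma Delta_atE : Delta_at alpha Z = \sum_j (incl j *m proj j) *t Z j.
Proof.
apply/matrixP=> a b; rewrite castmxE summxE.
case: (mxtens_indexP a) => a1 a2; case: (mxtens_indexP b) => b1 b2.
(* Both orderings are lexicographic, with the block first and the tensor index last, so the two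
   positions are the same integer. *)
have cast_index (c : 'I_(\sum_j gr_dim alpha j)%N) (e : 'I_n) :
    cast_ord (esym (Delta_dim alpha n)) (mxtens_index (c, e))
      = tagnat.Rank (tagnat.sig1 c) (mxtens_index (tagnat.sig2 c, e)).
  apply: val_inj; rewrite [RHS]tagnat.RankEsum /= (tagnat.rect c) mulnDl.
  by rewrite big_distrl addnA.
rewrite !cast_index mxdiag_Rank.
under eq_bigr => j _ do rewrite tensmxE gr_incl_proj -{1}(tagnat.sig2K a1)
  -{1}(tagnat.sig2K b1) mxdiag_Rank.
set i := tagnat.sig1 a1; set k := tagnat.sig1 b1.
move: (tagnat.sig2 a1) (tagnat.sig2 b1); rewrite -/i -/k => a' b'.
have [ik|ik] := eqVneq i k; last first.
  by rewrite mxE big1 // => j _; rewrite mxE mul0r.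
rewrite (bigD1 i) //= eqxx big1 => [|j /negPf ji].
  by case: _ / ik b' => b'; rewrite !conform_mx_id tensmxE addr0.
by rewrite eq_sym ji; case: _ / ik b' => b'; rewrite conform_mx_id mxE mul0r.
Qed.

Lemma phi_atE k : phi_at alpha Z k = tresolvent gr_step C (incl k) Z.
Proof.
rewrite /phi_at /tresolvent Delta_atE mulmx_suml; congr (_ *m invmx (_ - _) *m _).
by apply: eq_bigr => j _; rewrite tensmx_mul mulmx1.
Qed.

End Evaluation.
End Node.

(** * Operator norm estimates *)

Section OperatorNorm.
Variable R : realType.
Local Notation normc := ComplexField.Normc.normc.

Lemma normc_ge0 (z : R[i]) : 0 <= normc z.
Proof. by case: z => a b; apply: sqrtr_ge0. Qed.

Lemma normc_real (a : R) : normc a%:C%C = `|a|.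
Proof. by rewrite /= expr0n addr0 sqrtr_sqr. Qed.

Lemma le_normc_sum (I : finType) (f : I -> R[i]) :
  normc (\sum_i f i) <= \sum_i normc (f i).
Proof.
apply: (big_ind2 (fun z a => normc z <= a)) => //.
  by rewrite ComplexField.Normc.normc0.
move=> z a z' a' za za'; apply: le_trans (lerD za za').
exact: le_normcD.
Qed.

Lemma normc_le_l2norm m (x : 'cV[R[i]]_m) i : normc (x i 0) <= l2norm x.
Proof.
rewrite -[normc _]ger0_norm ?normc_ge0 // -sqrtr_sqr ler_wsqrtr //.
by rewrite (bigD1 i) //= lerDl sumr_ge0 // => j _; apply: sqr_ge0.
Qed.

Lemma l2norm_le_sum m (x : 'cV[R[i]]_m) : l2norm x <= \sum_i normc (x i 0).
Proof.
have S0 : 0 <= \sum_i normc (x i 0) by apply: sumr_ge0 => i _; apply: normc_ge0.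
rewrite -[leRHS]ger0_norm // -sqrtr_sqr ler_wsqrtr // expr2 mulr_suml.
apply: ler_sum => i _; rewrite expr2 ler_wpM2l ?normc_ge0 //.
by rewrite (bigD1 i) //= lerDl sumr_ge0 // => j _; apply: normc_ge0.
Qed.

Lemma opnorm_le_sum m n (M : 'M[R[i]]_(m, n)) :
  opnorm M <= \sum_i \sum_j normc (M i j).
Proof.
apply: ge_sup.
  exists (l2norm (M *m 0)), 0 => //.
  rewrite /l2norm big1 ?sqrtr0 // => i _.
  by rewrite mxE ComplexField.Normc.normc0 expr0n.
move=> _ [x x1 ->]; apply: le_trans (l2norm_le_sum _) _; apply: ler_sum => i _.
rewrite mxE; apply: le_trans (le_normc_sum _) _; apply: ler_sum => j _.
rewrite ComplexField.Normc.normcM ler_piMr ?normc_ge0 //.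
exact: le_trans (normc_le_l2norm _ _) x1.
Qed.

Lemma Gamma_shrink N n (eps : R) (Z : 'I_N -> 'M[R[i]]_n) : 0 < eps ->
  exists t : nat -> R[i], [/\ injective t, forall i, t i != 0
    & forall i, @Gamma R N n eps (fun k => t i *: Z k)].
Proof.
move=> eps0; pose K k := \sum_i \sum_j normc (Z k i j).
have K0 k : 0 <= K k.
  by apply: sumr_ge0 => i _; apply: sumr_ge0 => j _; apply: normc_ge0.
have S0 : 0 < 1 + \sum_k K k by rewrite ltr_pwDl // sumr_ge0.
(* The summand 1 prevents division by zero and makes the final bound strict; the factor 1 / (i + 1)
   makes the scalars distinct. *)
pose s i : R := eps / (1 + \sum_k K k) / i.+1%:R.
have s0 i : 0 < s i by rewrite !divr_gt0 // ltr0Sn.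
exists (fun i => (s i)%:C%C); split=> [i j|i|i k].
- move=> /complexI /(mulfI (lt0r_neq0 (divr_gt0 eps0 S0))) /invr_inj /eqP.
  by rewrite eqr_nat => /eqP[].
- by rewrite -(rmorph0 (real_complex R)) (inj_eq (@complexI R)) gt_eqF.
apply: le_lt_trans (opnorm_le_sum _) _.
have -> : \sum_a \sum_b normc (((s i)%:C%C *: Z k) a b) = s i * K k.
  rewrite mulr_sumr; apply: eq_bigr => a _; rewrite mulr_sumr; apply: eq_bigr => b _.
  by rewrite mxE ComplexField.Normc.normcM normc_real gtr0_norm.
have leS : s i <= eps / (1 + \sum_k K k).
  by rewrite /s ler_pdivrMr ?ltr0Sn // ler_peMr ?ler1n // ltW // divr_gt0.
apply: le_lt_trans (ler_wpM2r (K0 k) leS) _.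
rewrite -mulrA gtr_pMr // mulrC ltr_pdivrMr // mul1r (bigD1 k) //= addrCA.
by rewrite ltrDl ltr_pwDl // sumr_ge0.
Qed.

End OperatorNorm.

(** * The kernel and range conditions *)

Section Kernel.
Variables (R : realType) (N q p : nat) (alpha : GRnode R N q p).

Lemma phi_at_eq0 k n (Z : 'I_N -> 'M[R[i]]_n) (v : 'cV_(gr_dim alpha k)) (u : 'cV_n) :
  (forall w, obs_mx alpha k w *m v = 0) -> phi_at alpha Z k *m (v *t u) = 0.
Proof.
move=> Ov0; rewrite phi_atE; apply: tresolvent_eq0 => w.
by rewrite mulmxA -CflatAE; apply: Ov0.
Qed.

(** For positive [d], r - 1 is at most f = dr - 1, and f <= f ^ f always, with 0 ^ 0 = 1; if dr = 1
    then r - 1 = 0. *)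
Lemma admissible_ge d r n :
  admissible_size (d * r) n -> (d == 0)%N || (r.-1 <= n)%N.
Proof.
case: d => // d [n_gt0 size_n]; rewrite /=.
have le_r : (r <= d.+1 * r)%N by rewrite leq_pmull.
have [e|ne] := eqVneq (d.+1 * r)%N 1%N.
  by apply: leq_trans n_gt0; rewrite e in le_r; case: (r) le_r => [|[]].
apply: leq_trans (size_n (elimN eqP ne)); move: (d.+1 * r)%N le_r => e le_re.
have {le_re} : (r.-1 <= e.-1)%N by rewrite -!subn1 leq_sub2r.
move=> /leq_trans; apply; case: (e.-1) => // -[|f] //.
by rewrite -{1}(expn1 f.+2) leq_exp2l.
Qed.

Lemma admissible_exists d : exists n, admissible_size d n.+1.
Proof. by exists (d.-1 ^ d.-1)%N; split. Qed.

Lemma phi_at_detect k n (x : 'cV_(gr_dim alpha k * n)) :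
  admissible_size (p * gr_order alpha) n ->
  (forall v : 'cV_(gr_dim alpha k), (forall w, obs_mx alpha k w *m v = 0) -> v = 0) ->
  (forall Z : 'I_N -> 'M[R[i]]_n, exists t : nat -> R[i],
     [/\ injective t, forall i, t i != 0
       & forall i, phi_at alpha (fun j => t i *: Z j) k *m x = 0]) ->
  x = 0.
Proof.
case: n x => [|n] x size_n obs x0; first by case: size_n.
apply: (@tresolvent_detect _ _ _ _ _ (gr_step alpha) (gr_C alpha) (gr_incl alpha k)).
- exact: admissible_ge size_n.
- by move=> v Cv0; apply: obs => w; rewrite /obs_mx CflatAE -mulmxA; apply: Cv0.
- move=> Z; have [t [t_inj t_neq0 tx0]] := x0 Z.
  exists t; split; [exact: t_inj | exact: t_neq0 | move=> i].
  by rewrite -phi_atE; apply: tx0.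
Qed.

Lemma tens_delta_inj m n (v : 'cV[R[i]]_m) (mu : 'I_n) :
  v *t delta_mx mu (0 : 'I_1) = 0 -> v = 0.
Proof.
move=> /matrixP vmu0; apply/matrixP=> i j; rewrite ord1 mxE.
have := vmu0 (mxtens_index (i, mu)) (mxtens_index (0, 0)).
by rewrite tensmxE !mxE !eqxx mulr1.
Qed.

Lemma observable_kernel_condition (eps : R) : 0 < eps ->
  observable alpha <-> kernel_condition alpha eps.
Proof.
move=> eps0; split=> [obs k n size_n|kc k].
  apply/seteqP; split=> x /=; last by move=> -> Z _; rewrite /mxker /= mulmx0.
  move=> x0; apply: phi_at_detect size_n _ _; first exact/has_rank_colP/obs.
  move=> Z; have [t [t_inj t_neq0 tG]] := Gamma_shrink Z eps0.
  by exists t; split; [exact: t_inj | exact: t_neq0 | move=> i; apply: x0].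
apply/has_rank_colP => v Ov0.
(* One admissible size suffices: an unobservable [v] tensored with a basis vector lies in every
   kernel. *)
have [n size_n] := admissible_exists (p * gr_order alpha).
apply: (@tens_delta_inj _ n.+1 _ ord0).
have : (\bigcap_(Z in @Gamma R N n.+1 eps) mxker (phi_at alpha Z k))%classic
    (v *t delta_mx ord0 (0 : 'I_1)) by move=> Z _; apply: phi_at_eq0.
by rewrite kc.
Qed.

End Kernel.

(** * Duality by transposition *)

Section Transpose.
Variables (R : realType) (N q p : nat) (alpha : GRnode R N q p).

(** The plain transpose rather than the adjoint, so that evaluation dualizes without conjugation. *)
Definition gr_trmx : GRnode R N p q :=
  @MkGRnode R N p q (gr_dim alpha)
    (gr_A alpha)^T (gr_C alpha)^T (gr_B alpha)^T (gr_D alpha)^T.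

Lemma tr_gr_incl k : (gr_incl alpha k)^T = gr_proj alpha k.
Proof. by rewrite /gr_incl tr_submxrow trmx1. Qed.

Lemma phi_at_trmx n (Z : 'I_N -> 'M[R[i]]_n) k :
  phi_at gr_trmx Z k = (psi_at alpha (fun j => (Z j)^T) k)^T.
Proof.
rewrite /psi_at !trmx_mul !trmx_tens trmx_inv /phi_at mulmxA !trmx1.
have DE : Delta_at gr_trmx Z = (Delta_at alpha (fun j => (Z j)^T))^T.
  rewrite !Delta_atE linear_sum; apply: eq_bigr => j _ /=.
  by rewrite trmx_tens trmxK trmx_mul -tr_gr_incl trmxK tr_gr_incl.
rewrite DE -tr_gr_incl trmxK; congr (_ *m invmx _ *m _).
by rewrite raddfB /= trmx1 trmx_mul trmx_tens trmx1.
Qed.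

Definition gr_costep (j : 'I_N) : 'M[R[i]]_(gr_order alpha) :=
  gr_A alpha *m (gr_incl alpha j *m gr_proj alpha j).

Lemma AsharpBE k w : AsharpB alpha k w =
  gr_proj alpha k *m word_mx gr_costep w *m gr_B alpha.
Proof.
elim: w k => [|j w IHw] k /=; first by rewrite /word_mx big_nil mulmx1 gr_proj_mul.
by rewrite IHw blockAE word_mx_cons /gr_costep !mulmxA.
Qed.

Lemma word_mx_trmx (w : word N) :
  word_mx (gr_step gr_trmx) w = (word_mx gr_costep (rev w))^T.
Proof.
elim: w => [|j w IHw]; first by rewrite /word_mx !big_nil trmx1.
rewrite rev_cons word_mx_rcons trmx_mul word_mx_cons -IHw; congr (_ *m _).
by rewrite /gr_costep !trmx_mul -tr_gr_incl trmxK tr_gr_incl.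
Qed.

Lemma obs_mx_trmx k w : obs_mx gr_trmx k w = (ctrl_mx alpha k w)^T.
Proof.
rewrite /obs_mx /ctrl_mx CflatAE AsharpBE !trmx_mul -tr_gr_incl trmxK.
by rewrite mulmxA word_mx_trmx.
Qed.

Lemma controllable_trmx : controllable alpha <-> observable gr_trmx.
Proof.
have rkE k (ws : seq (word N)) :
    \rank (\mxrow_(i < size ws) ctrl_mx alpha k (nth [::] ws i))
      = \rank (\mxcol_(i < size ws) obs_mx gr_trmx k (nth [::] ws i)).
  rewrite -mxrank_tr tr_mxrow; congr (\rank _).
  by apply: eq_mxcol => i; rewrite obs_mx_trmx.
split=> rk k; have [[ws rk_ws] rk_le] := rk k; split.
- by exists ws; rewrite -rkE.
- by move=> ws'; rewrite -rkE.
- by exists ws; rewrite rkE.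
- by move=> ws'; rewrite rkE.
Qed.

Lemma controllable_range_condition (eps : R) : 0 < eps ->
  controllable alpha <-> range_condition alpha eps.
Proof.
move=> eps0; rewrite controllable_trmx; split=> [obs k n size_n|rc k].
  (* Indexing by the points of [Gamma] lets [row_full_family] pick finitely many of them whose
     ranges already fill the space. *)
  pose T := {Z : 'I_N -> 'M[R[i]]_n | @Gamma R N n eps Z}.
  have [Zs /row_fullP[B B1]] : exists ts : seq T,
      row_full (\mxcol_(i < size ts) (psi_at alpha (sval (tnth (in_tuple ts) i)) k)^T).
    have [|ts full_ts] :=
        @row_full_family _ T _ _ (fun Z => (psi_at alpha (sval Z) k)^T).
      move=> x x0; apply: (@phi_at_detect _ _ _ _ gr_trmx k n x).
      - by rewrite mulnC.
      - exact/has_rank_colP/obs.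
      (* The scalars are fitted to the transposed tuple, since that is where [psi_at] is
         evaluated. *)
      - move=> Z; have [t [t_inj t_neq0 tG]] := Gamma_shrink (fun j => (Z j)^T) eps0.
        exists t; split; [exact: t_inj | exact: t_neq0 | move=> i]; rewrite phi_at_trmx.
        have := x0 (exist _ _ (tG i)); rewrite /=.
        by under [fun j => (_ *: Z j)^T]eq_fun do rewrite linearZ.
    exists ts; rewrite /row_full eqmx_col.
    by move: full_ts; rewrite big_tnth.
  apply/seteqP; split=> // v _.
  pose psi i := psi_at alpha (sval (tnth (in_tuple Zs) i)) k.
  (* [B^T] is a right inverse of the row of blocks [psi i], so the blocks of [y] are the required
     preimages. *)
  pose y := B^T *m v; exists [seq (1, psi i *m submxcol y i) | i <- enum 'I_(size Zs)].
  split=> [_ /mapP[i _ ->]|].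
    by exists (sval (tnth (in_tuple Zs) i)); [exact: svalP | exists (submxcol y i)].
  rewrite big_map big_enum /=; under eq_bigr do rewrite scale1r.
  rewrite -mul_mxrow_mxcol submxcolK /y mulmxA.
  have -> : \mxrow_i psi i *m B^T = 1%:M.
    rewrite -[LHS]trmxK trmx_mul trmxK tr_mxrow -[RHS]trmx1; congr (_^T).
    exact: B1.
  by rewrite mul1mx.
apply/has_rank_colP => v Ov0.
have [n size_n] := admissible_exists (gr_order alpha * q).
apply: (@tens_delta_inj _ _ n.+1 _ ord0); set x := v *t _.
(* The transpose of [x] annihilates every range; as the ranges span, [x] must vanish. *)
have psi0 Z : x^T *m psi_at alpha Z k = 0.
  have := @phi_at_eq0 R N p q gr_trmx k n.+1 (fun j => (Z j)^T) v (delta_mx ord0 0) Ov0.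
  rewrite phi_at_trmx => /(congr1 trmx); rewrite trmx_mul trmxK trmx0.
  by under [fun j => (_^T)^T]eq_fun do rewrite trmxK.
have x0 (y : 'cV[R[i]]_(gr_dim alpha k * n.+1)) : x^T *m y = 0.
  have [s [sG ->]] : linspan
      (\bigcup_(Z in @Gamma R N n.+1 eps) mxran (psi_at alpha Z k))%classic y.
    by rewrite rc.
  rewrite mulmx_sumr big_seq big1 // => a /sG[Z _ [u ->]].
  by rewrite -scalemxAr mulmxA psi0 mul0mx scaler0.
apply: trmx_inj; rewrite trmx0; apply/matrixP=> i j.
by have /matrixP/(_ i 0) := x0 (delta_mx j 0); rewrite -colE !mxE.
Qed.

End Transpose.

(** * Hankel factorization of the transfer function *)

Section LetterSeries.
Variables (R : realType) (N : nat).

Lemma fps_mul_constl m n l (X : 'M[R[i]]_(m, n)) (g : fps R N n l) w :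
  fps_mul (fps_const X) g w = X *m g w.
Proof.
rewrite /fps_mul big_ord_recl take0 drop0 big1 ?addr0 //= => i _.
by case: w i => [|j w] [] //= i _; rewrite mul0mx.
Qed.

Lemma fps_mul_lettersl m n l (f : fps R N m n) (g : fps R N n l) j w :
  (forall u, size u != 1 -> f u = 0) ->
  fps_mul f g (j :: w) = f [:: j] *m g w.
Proof.
move=> f0; rewrite /fps_mul big_ord_recl /= f0 // mul0mx add0r.
rewrite big_ord_recl /= take0 drop0 big1 ?addr0 // => i _.
rewrite f0 ?mul0mx //=; case: w i => [|j' w] [] //= i.
Qed.

Lemma fps_mul_lettersr m n l (f : fps R N m n) (g : fps R N n l) w j :
  (forall u, size u != 1 -> g u = 0) ->
  fps_mul f g (rcons w j) = f w *m g [:: j].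
Proof.
move=> g0; rewrite /fps_mul size_rcons big_ord_recr /= drop_oversize ?size_rcons //.
rewrite g0 // mulmx0 addr0 big_ord_recr /= big1 ?add0r => [|i _].
  by rewrite -cats1 take_size_cat // drop_size_cat.
rewrite g0 ?mulmx0 // size_drop size_rcons subSn ?(ltnW (ltn_ord i)) //.
by rewrite eqSS subn_eq0 -ltnNge.
Qed.

End LetterSeries.

Section Hankel.
Variables (R : realType) (N q p : nat) (alpha : GRnode R N q p).

Lemma fps_Delta_letters u : size u != 1 -> fps_Delta alpha u = 0.
Proof. by case: u => [|j []]. Qed.

Lemma fps_Delta_mul m (X : 'M_(gr_order alpha, m)) w :
  fps_mul (fps_Delta alpha) (fps_const X) w =
    if w is [:: j] then gr_incl alpha j *m gr_proj alpha j *m X else 0.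
Proof.
case: w => [|j w]; first by rewrite /fps_mul big_ord1 /= mul0mx.
rewrite (fps_mul_lettersl _ _ _ fps_Delta_letters).
case: w => [|? ?]; rewrite /= ?mulmx0 //.
by rewrite gr_incl_proj.
Qed.

(** The series inverted is supported on single letters, so its k-th power lives on words of length k
    and only [k = size w] contributes. *)
Lemma fps_resolventE w :
  fps_inv1B (fps_mul (fps_Delta alpha) (fps_const (gr_A alpha))) w
    = word_mx (gr_step alpha) w.
Proof.
set f := fps_mul _ _.
have f0 u : size u != 1 -> f u = 0 by rewrite /f fps_Delta_mul; case: u => [|j []].
have expE k u : fps_exp f k u = if size u == k then word_mx (gr_step alpha) u else 0.
  elim: k u => [|k IHk] [|j u] //=; first by rewrite /word_mx big_nil.
    by rewrite /fps_mul big_ord1 /= f0 // mul0mx.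
  rewrite fps_mul_lettersl // -/(fps_exp f k) IHk eqSS word_mx_cons.
  by case: eqP; rewrite ?mulmx0 // /f fps_Delta_mul.
rewrite /fps_inv1B (bigD1 ord_max) //= expE eqxx big1 ?addr0 // => i /eqP i_neq.
by rewrite expE; case: eqP => // e; case: i_neq; apply: val_inj.
Qed.

Lemma transfer_rcons w j : transfer alpha (rcons w j) =
  gr_C alpha *m word_mx (gr_step alpha) w *m (gr_incl alpha j *m gr_proj alpha j)
    *m gr_B alpha.
Proof.
rewrite /transfer /fps_add {1}/fps_const; have -> : forall T (a b : T),
  (if rcons w j is [::] then a else b) = b by case: (w).
rewrite add0r fps_mul_constl fps_mul_lettersr => [|u]; last first.
  by rewrite fps_Delta_mul; case: u => [|? []].
by rewrite fps_resolventE fps_Delta_mul !mulmxA.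
Qed.

(** Rebracketing turns factors E_j A into factors A E_j. *)
Lemma word_mx_shift w j :
  gr_A alpha *m word_mx (gr_step alpha) w *m (gr_incl alpha j *m gr_proj alpha j)
    = word_mx (gr_costep alpha) (rcons w j).
Proof.
elim: w => [|l w IHw]; first by rewrite word_mx_rcons /word_mx !big_nil mulmx1 mul1mx.
by rewrite rcons_cons !word_mx_cons -IHw /gr_step /gr_costep !mulmxA.
Qed.

(** The projection attached to the letter [k] is [gr_incl k *m gr_proj k]; cutting the product
    between these factors separates the two sides. *)
Lemma transfer_Hankel w k w' :
  transfer alpha (w ++ k :: w') = CflatA alpha w k *m AsharpB alpha k w'.
Proof.
rewrite CflatAE AsharpBE; case: (lastP w') => [|{}w' j].
  by rewrite cats1 transfer_rcons /word_mx !big_nil mulmx1 !mulmxA.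
rewrite -rcons_cons -rcons_cat transfer_rcons -word_mx_shift /word_mx.
by rewrite big_cat big_cons /= /gr_step !mulmxA.
Qed.

End Hankel.

(** * Minimality by comparing ranks of finite Hankel sections *)

Lemma observable_controllable_minimal (R : realType) (N q p : nat)
    (alpha : GRnode R N q p) :
  observable alpha -> controllable alpha -> minimal alpha.
Proof.
move=> obs ctrl beta eq_tr k.
have [[ws rk_ws] _] := obs k; have [[vs rk_vs] _] := ctrl k.
set O := mxcol _ in rk_ws; set Ct := mxrow _ in rk_vs.
pose O' := \mxcol_(i < size ws) obs_mx beta k (nth [::] ws i).
pose Ct' := \mxrow_(i < size vs) ctrl_mx beta k (nth [::] vs i).
have eqH : O *m Ct = O' *m Ct'.
  rewrite !mul_mxcol_mxrow; apply: eq_mxblock => i j.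
  by rewrite /obs_mx /ctrl_mx -!transfer_Hankel eq_tr.
(* [Ct] has full row rank, so the product keeps the rank of [O]; the factorization for [beta] passes
   through dimension [gr_dim beta k]. *)
have <- : \rank (O *m Ct) = gr_dim alpha k.
  by rewrite mxrankMfree // /row_free rk_vs.
by rewrite eqH mulmx_max_rank.
Qed.

Theorem theorem3p7 (R : realType) (N q p : nat) (alpha : GRnode R N q p)
    (eps : R) (eps_gt0 : 0 < eps)
    (epsE : gr_A alpha <> 0 -> eps = (opnorm (gr_A alpha))^-1) :
  [/\ observable alpha <-> kernel_condition alpha eps,
      controllable alpha <-> range_condition alpha eps
    & kernel_condition alpha eps /\ range_condition alpha eps -> minimal alpha].
Proof.
have obsP := observable_kernel_condition alpha eps_gt0.
have ctrlP := controllable_range_condition alpha eps_gt0.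
split; [exact: obsP | exact: ctrlP | case=> /obsP obs /ctrlP ctrl].
exact: observable_controllable_minimal.
Qed.
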